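(* Let $\mathcal{F}$ and $\mathcal{G}$ be proper nontrivial subspaces of a real or complex Hilbert space $\mathcal{H}$, and let $$\gamma(\mathcal{F},\mathcal{G})=\inf_{f\in\mathcal{F},\ f\notin\mathcal{G}}\frac{\mathrm{dist}(f,\mathcal{G})}{\mathrm{dist}(f,\mathcal{F}\cap\mathcal{G})}$$ be the minimum gap. Then $$\gamma(\mathcal{F},\mathcal{G})=\sin\left(\inf\{\Theta(\mathcal{F},\mathcal{G})\setminus\{0\}\}\right).$$
   Context: A subspace means a closed linear manifold; nontrivial means different from $\{0\}$, proper means different from $\mathcal{H}$. $\mathrm{dist}(f,\mathcal{S})=\inf_{s\in\mathcal{S}}\|f-s\|$. By convention $\gamma(\mathcal{F},\mathcal{G})=1$ if $\mathcal{F}\subseteq\mathcal{G}$. $P_{\mathcal{F}}$ denotes the orthogonal projector onto $\mathcal{F}$; $\Sigma$ denotes the spectrum; $(P_{\mathcal{F}}P_{\mathcal{G}})|_{\mathcal{F}}$ is regarded as an operator $\mathcal{F}\to\mathcal{F}$. The set of angles from $\mathcal{F}$ to $\mathcal{G}$ is $$\hat{\Theta}(\mathcal{F},\mathcal{G})=\{\theta:\theta=\arccos(\sigma),\ \sigma\ge 0,\ \sigma^2\in\Sigma((P_{\mathcal{F}}P_{\mathcal{G}})|_{\mathcal{F}})\}\subseteq[0,\pi/2],$$ and the set of angles between $\mathcal{F}$ and $\mathcal{G}$ is $\Theta(\mathcal{F},\mathcal{G})=\hat{\Theta}(\mathcal{F},\mathcal{G})\cap\hat{\Theta}(\mathcal{G},\mathcal{F})$.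 The infimum of angles is taken in $[0,\pi/2]$, so that $\inf\emptyset=\pi/2$. *)

(* Defs.v *)
From HB Require Import structures.
From mathcomp Require Import all_boot all_order all_algebra sesquilinear.
From mathcomp Require Import all_classical all_reals all_analysis.
From mathcomp Require Import complex.

Set Implicit Arguments.
Unset Strict Implicit.
Unset Printing Implicit Defensive.

Import Order.TTheory GRing.Theory Num.Theory.
Import numFieldNormedType.Exports.

Local Open Scope classical_set_scope.
Local Open Scope ring_scope.

Variant scalars := RealScalars | ComplexScalars.

Section ScalarField.
Variable R : realType.

Definition scalar_field (s : scalars) : numFieldType :=
  match s with
  | RealScalars => R : numFieldType
  | ComplexScalars => R[i] : numFieldType
  end.

Definition scalar_conj (s : scalars) :
    {rmorphism scalar_field s -> scalar_field s} :=
  match s with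
  | RealScalars => (idfun : {rmorphism R -> R})
  | ComplexScalars => (@conjc R : {rmorphism R[i] -> R[i]})
  end.

Definition scalar_re (s : scalars) : scalar_field s -> R :=
  match s with
  | RealScalars => idfun
  | ComplexScalars => @complex.Re R
  end.

Definition scalar_of_real (s : scalars) : R -> scalar_field s :=
  match s with
  | RealScalars => idfun
  | ComplexScalars => @real_complex R
  end.

(* The norm of a normed module takes its values in the field of scalars, hence
   the equation below needs no real square root. *)
Record hilbertType (s : scalars) := HilbertType {
  hilbert_sort :> completeNormedModType (scalar_field s);
  hdot : {dot hilbert_sort for scalar_conj s};
  hilbert_normE : forall x : hilbert_sort, `|x| ^+ 2 = hdot x x
}.

End ScalarField.

Section Angles.
Variables (R : realType) (s : scalars) (H : hilbertType R s).
Local Notation K := (scalar_field R s).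
Implicit Types (F G S : set H) (f x y : H).

Definition hnorm x : R := scalar_re `|x|.

Definition is_subspace F : Prop :=
  submod_closed [in F] /\ closed F.

Definition dist f S : R := inf [set hnorm (f - x) | x in S].

Definition minimum_gap F G : R :=
  if `[< F `<=` G >] then 1
  else inf [set dist f G / dist f (F `&` G) | f in F `\` G].

(* P_F x is the point p of F with x - p orthogonal to F. *)
Definition orth_proj F x : H :=
  get [set p | F p /\ forall y, F y -> hdot H (x - p) y = 0].

(* Bounded linear operators F -> F are represented by functions H -> H whose
   values outside F are irrelevant. *)
Definition bounded_operator_on F (T : H -> H) : Prop :=
  [/\ forall x, F x -> F (T x),
      forall (a : K) x y, F x -> F y -> T (a *: x + y) = a *: T x + T y &
      exists M : K, forall x, F x -> `|T x| <= M * `|x|].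

Definition inverse_on F (T U : H -> H) : Prop :=
  forall x, F x -> U (T x) = x /\ T (U x) = x.

Definition spectrum_on F (T : H -> H) : set K :=
  [set l | ~ exists U : H -> H,
      bounded_operator_on F U /\ inverse_on F (fun x => T x - l *: x) U].

Definition angles_from F G : set R :=
  [set acos sigma | sigma in [set sigma : R | 0 <= sigma /\
    spectrum_on F (orth_proj F \o orth_proj G)
      (scalar_of_real s (sigma ^+ 2))]].

Definition angles_between F G : set R :=
  angles_from F G `&` angles_from G F.

(* Infimum in the poset [0, pi/2]; inf set0 would be 0 in R. *)
Definition angle_inf (A : set R) : R :=
  if `[< A = set0 >] then pi / 2 else inf A.

End Angles.

(* Main.v *)
Require Import Defs.
From mathcomp Require Import all_boot all_order all_algebra sesquilinear.
From mathcomp Require Import all_classical all_reals all_analysis.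
From mathcomp Require Import complex ring lra.

Set Implicit Arguments.
Unset Strict Implicit.
Unset Printing Implicit Defensive.

Import Order.TTheory GRing.Theory Num.Theory.
Import numFieldNormedType.Exports.
Local Open Scope classical_set_scope.
Local Open Scope ring_scope.

(** Write M for the intersection of F and G, T for the operator P_F P_G on F,
    and C = 1 - T. Since <C f, f> = |f - P_G f|^2 = dist(f, G)^2 for f in F, the
    operator C is nonnegative with kernel M. Subtracting from f its projection
    on M changes neither dist(f, G) nor dist(f, M). So, unless F is contained in
    G, the square of the minimum gap is the largest m such that
    m |f|^2 <= <C f, f> for all f in F orthogonal to M.

    A symmetric operator B on F has a bounded inverse as soon as it is bounded
    below; a real number is therefore in the spectrum exactly when it is an
    approximate eigenvalue ([spectrum_approx_null]). The theorem then amounts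
    to two facts about the spectrum of T, with e ranging over positive reals.

    - [gap_bound_spectrum]: if e |f|^2 <= <C f, f> on the complement of M, then
      every spectral value of T other than 1 is at most 1 - e. This bounds the
      sines of all nonzero angles below by the gap.
    - [spectrum_gap_bound]: if T has no spectral value in ]1 - e, 1[, then
      e |f|^2 <= <C f, f> on the complement of M. Hence, if the gap is less than
      1, there are nonzero angles whose sine is as close to it as desired.

    The second fact is the harder one: when the gap is 0, it says that 0, which
    is not an eigenvalue of C on the complement of M, is not isolated in the
    spectrum either. No functional calculus is needed. If C has no spectral
    value in ]0, e[, then (C - e/2)^2 >= (e/2)^2 ([spectral_gap]), which expands
    to C^2 >= e C. Dividing by C is legitimate away from the kernel, because the
    range of C is dense there ([square_gap]).

    Finally P_G maps approximate eigenvectors of P_F P_G for a positive value to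
    approximate eigenvectors of P_G P_F for the same value
    ([approx_null_swap]), so an angle from F to G other than pi/2 is also an
    angle from G to F.

    The real and the complex case are treated together by working with the real
    part of the inner product, for which all operators at hand are still
    symmetric. *)

(** * Real and complex scalars *)

Section Scalars.
Variables (R : realType) (s : scalars).
Local Notation K := (scalar_field R s).
Implicit Types (a b : K) (r t : R).

Lemma scalar_reD a b : scalar_re (a + b) = scalar_re a + scalar_re b.
Proof. by case: s a b => [|] // [? ?] [? ?]. Qed.

Lemma scalar_re_conj a : scalar_re (scalar_conj R s a) = scalar_re a.
Proof. by case: s a => [|] // [? ?]. Qed.

Lemma scalar_reZ r a : scalar_re (scalar_of_real s r * a) = r * scalar_re a.
Proof. by case: s a => [|] // [? ?] /=; rewrite mul0r subr0. Qed.

Lemma scalar_re_real r : scalar_re (scalar_of_real s r) = r.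
Proof. by case: s. Qed.

Lemma scalar_of_real0 : scalar_of_real s 0 = 0 :> K.
Proof. by case: s. Qed.

Lemma scalar_of_real1 : scalar_of_real s 1 = 1 :> K.
Proof. by case: s. Qed.

Lemma scalar_of_realD r t :
  scalar_of_real s (r + t) = scalar_of_real s r + scalar_of_real s t.
Proof. by case: s => //=; exact: rmorphD. Qed.

Lemma scalar_of_realM r t :
  scalar_of_real s (r * t) = scalar_of_real s r * scalar_of_real s t.
Proof. by case: s => //=; exact: rmorphM. Qed.

Lemma scalar_of_realN r : scalar_of_real s (- r) = - scalar_of_real s r.
Proof. by case: s => //=; exact: rmorphN. Qed.

Lemma ler_scalar_re a b : a <= b -> scalar_re a <= scalar_re b.
Proof. by case: s a b => // a b; rewrite lecE => /andP[]. Qed.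

Lemma ltr_scalar_re a b : a < b -> scalar_re a < scalar_re b.
Proof. by case: s a b => // a b; rewrite ltcE => /andP[]. Qed.

Lemma ler_scalar_of_real r t :
  r <= t -> scalar_of_real s r <= scalar_of_real s t.
Proof. by case: s => //= ?; rewrite lecR. Qed.

Lemma ltr_scalar_of_real r t :
  r < t -> scalar_of_real s r < scalar_of_real s t.
Proof. by case: s => //= ?; rewrite ltcR. Qed.

Lemma scalar_reK a : 0 <= a -> scalar_of_real s (scalar_re a) = a.
Proof. by case: s a => // a a0; rewrite /= RRe_real// ger0_real. Qed.

Lemma scalar_mul_conj_eq0 a : scalar_re (a * scalar_conj R s a) = 0 -> a = 0.
Proof.
case: s a => [a /= /eqP|[x y] /= /eqP]; first by rewrite mulf_eq0 orbb => /eqP.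
rewrite mulrN opprK -!expr2 paddr_eq0 ?sqr_ge0// !sqrf_eq0.
by case/andP => /eqP -> /eqP ->.
Qed.

End Scalars.

Lemma invn_small (R : realType) (c e : R) : 0 <= c -> 0 < e ->
  exists n0, forall n, (n0 <= n)%N -> c * n.+1%:R^-1 < e.
Proof.
move=> c0 e0; exists (Num.bound (c / e)) => n le_n.
rewrite ltr_pdivrMr ?ltr0n// mulrC -ltr_pdivrMr//.
apply: lt_le_trans (archi_boundP (divr_ge0 c0 (ltW e0))) _.
by rewrite ler_nat leqW.
Qed.

(** * The real part of the inner product *)

Section RealInnerProduct.
Variables (R : realType) (s : scalars) (H : hilbertType R s).
Local Notation K := (scalar_field R s).
Implicit Types (x y z : H) (r t : R).

Definition rscale r x : H := scalar_of_real s r *: x.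
Local Notation "r *:% x" := (rscale r x) (at level 40).

Definition rdot x y : R := scalar_re (hdot H x y).
Definition sqnorm x : R := rdot x x.
Local Notation N := sqnorm.

Lemma rdotC x y : rdot x y = rdot y x.
Proof. by rewrite /rdot hermC expr0 mul1r scalar_re_conj. Qed.

Lemma rdotDl x y z : rdot (x + y) z = rdot x z + rdot y z.
Proof. by rewrite /rdot linearDl scalar_reD. Qed.

Lemma rdotZl r x y : rdot (r *:% x) y = r * rdot x y.
Proof. by rewrite /rdot linearZl_LR scalar_reZ. Qed.

Lemma rscaleN1 x : (-1) *:% x = - x.
Proof. by rewrite /rscale scalar_of_realN scalar_of_real1 scaleN1r. Qed.

Lemma rdotNl x y : rdot (- x) y = - rdot x y.
Proof. by rewrite -rscaleN1 rdotZl mulN1r. Qed.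

Lemma rdotBl x y z : rdot (x - y) z = rdot x z - rdot y z.
Proof. by rewrite rdotDl rdotNl. Qed.

Lemma rdotDr x y z : rdot z (x + y) = rdot z x + rdot z y.
Proof. by rewrite rdotC rdotDl !(rdotC z). Qed.

Lemma rdotZr r x y : rdot y (r *:% x) = r * rdot y x.
Proof. by rewrite rdotC rdotZl (rdotC y). Qed.

Lemma rdotBr x y z : rdot z (x - y) = rdot z x - rdot z y.
Proof. by rewrite rdotC rdotBl !(rdotC z). Qed.

Lemma rdot0r x : rdot x 0 = 0.
Proof. by rewrite -[in LHS](subrr x) rdotBr subrr. Qed.

Definition rdotE := (rdotBl, rdotBr, rdotDl, rdotDr, rdotZl, rdotZr).

Lemma hnormK x : scalar_of_real s (hnorm x) = `|x|.
Proof. exact: scalar_reK. Qed.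

Lemma hnorm_ge0 x : 0 <= hnorm x.
Proof. by rewrite -(scalar_re_real s 0) scalar_of_real0 ler_scalar_re. Qed.

Lemma sqnormE x : N x = hnorm x ^+ 2.
Proof.
by rewrite /N /rdot -hilbert_normE -hnormK expr2 -scalar_of_realM scalar_re_real.
Qed.

Lemma sqnorm_ge0 x : 0 <= N x. Proof. by rewrite sqnormE sqr_ge0. Qed.

Lemma sqnorm0 : N 0 = 0. Proof. exact: rdot0r. Qed.

Lemma sqnorm_eq0 x : (N x == 0) = (x == 0).
Proof.
apply/eqP/eqP => [/eqP|->]; last exact: sqnorm0.
rewrite sqnormE sqrf_eq0 => /eqP x0; apply/eqP.
by rewrite -normr_eq0 -hnormK x0 scalar_of_real0.
Qed.

Lemma sqnorm_gt0 x : x <> 0 -> 0 < N x.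
Proof. by move=> x0; rewrite lt_def sqnorm_ge0 sqnorm_eq0 andbT; apply/eqP. Qed.

Lemma sqnormN x : N (- x) = N x.
Proof. by rewrite /N rdotNl rdotC rdotNl opprK. Qed.

Lemma sqnormBC x y : N (x - y) = N (y - x).
Proof. by rewrite -sqnormN opprB. Qed.

Lemma hnormE x : hnorm x = Num.sqrt (N x).
Proof. by rewrite sqnormE sqrtr_sqr ger0_norm ?hnorm_ge0. Qed.

Lemma sqnormD_le x y : N (x + y) <= 2 * (N x + N y).
Proof.
have := sqnorm_ge0 (x - y); rewrite /N !rdotE (rdotC y x).
lra.
Qed.

Lemma rdot_sqr_le x y : rdot x y ^+ 2 <= N x * N y.
Proof.
have [->|/eqP y0] := eqVneq y 0; first by rewrite rdot0r sqnorm0 expr0n mulr0.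
have Ny := sqnorm_gt0 y0.
have := sqnorm_ge0 (x - (rdot x y / N y) *:% y).
have -> : N (x - (rdot x y / N y) *:% y) = N x - rdot x y ^+ 2 / N y.
  by rewrite /N !rdotE (rdotC y x); field; rewrite -/(N y) gt_eqF.
by rewrite subr_ge0 ler_pdivrMr.
Qed.

(** This particular Cauchy rate is the one produced both by minimising
    sequences and by approximate solutions of an equation. *)
Lemma sqnorm_complete (u : nat -> H) (c : R) :
  (forall n m, N (u n - u m) <= c * (n.+1%:R^-1 + m.+1%:R^-1)) ->
  exists x, forall e : R, 0 < e ->
    exists n0, forall n, (n0 <= n)%N -> N (x - u n) < e.
Proof.
move=> cau.
have c0 : 0 <= c.
  have := cau 0%N 0%N; rewrite subrr sqnorm0 invr1 => h; lra.
have small := invn_small c0.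
have cvu : cvgn u.
  apply: cauchy_cvg; apply: cauchy_exP => e e0.
  have re0 : 0 < scalar_re e by rewrite -(scalar_re_real s 0) scalar_of_real0 ltr_scalar_re.
  have [n0 hn0] := small (scalar_re e ^+ 2 / 2) ltac:(by rewrite divr_gt0// exprn_gt0).
  exists (u n0); exists n0 => // n /= le_n.
  rewrite -ball_normE /= -hnormK -(scalar_reK (ltW e0)) ltr_scalar_of_real//.
  rewrite -(@ltr_pXn2r _ 2%N) ?nnegrE ?hnorm_ge0 ?(ltW re0)// -sqnormE.
  apply: le_lt_trans (cau _ _) _; rewrite mulrDr.
  by rewrite [ltRHS]splitr ltrD// hn0.
exists (limn u) => e e0.
have : u n @[n --> \oo] --> limn u by [].
move=> /cvgrPdist_lt /(_ (scalar_of_real s (Num.sqrt e))).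
rewrite -(scalar_of_real0 R s) => /(_ (ltr_scalar_of_real _ _)).
rewrite sqrtr_gt0 => /(_ e0) [n0 _ hn0]; exists n0 => n le_n.
have := hn0 n le_n => /ltr_scalar_re; rewrite scalar_re_real -/(hnorm _) hnormE.
by rewrite ltr_sqrt.
Qed.

Lemma closed_sqnorm (F : set H) x :
  closed F -> (forall e : R, 0 < e -> exists2 y, F y & N (x - y) < e) -> F x.
Proof.
move=> clF apx; apply: clF => A /nbhs_ballP[e /= e0 xA].
have re0 : 0 < scalar_re e by rewrite -(scalar_re_real s 0) scalar_of_real0 ltr_scalar_re.
have [y Fy] := apx (scalar_re e ^+ 2) (exprn_gt0 _ re0).
rewrite sqnormE ltr_pXn2r ?nnegrE ?hnorm_ge0 ?(ltW re0)// => xy.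
exists y; split=> //; apply: xA; rewrite -ball_normE /=.
by rewrite -hnormK -(scalar_reK (ltW e0)) ltr_scalar_of_real.
Qed.

End RealInnerProduct.
Local Notation "r *:% x" := (rscale r x) (at level 40).
Local Notation N := sqnorm.

(** * Orthogonal projections *)

Section Projection.
Variables (R : realType) (s : scalars) (H : hilbertType R s).
Local Notation K := (scalar_field R s).
Implicit Types (x y z p : H) (r t : R) (a : K) (S F : set H).

Lemma submod0 S : submod_closed [in S] -> S 0.
Proof. by case=> + _; rewrite inE. Qed.

Lemma submod_comb S a x y : submod_closed [in S] -> S x -> S y -> S (a *: x + y).
Proof. by case=> _ cl Sx Sy; have := cl a x y; rewrite !inE; exact. Qed.

Lemma submodZ S a x : submod_closed [in S] -> S x -> S (a *: x).
Proof. by move=> cl Sx; rewrite -[_ *: _]addr0; apply: submod_comb (submod0 cl). Qed.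

Lemma submodD S x y : submod_closed [in S] -> S x -> S y -> S (x + y).
Proof. by move=> cl Sx Sy; rewrite -(scale1r x); apply: submod_comb. Qed.

Lemma submodB S x y : submod_closed [in S] -> S x -> S y -> S (x - y).
Proof. by move=> cl Sx Sy; rewrite addrC -scaleN1r; apply: submod_comb. Qed.

(** Any submodule S has best approximations, which may only lie in its closure:
    by the parallelogram law a minimising sequence is Cauchy. Not asking S to be
    closed lets the lemma apply to ranges of operators. *)
Lemma approx_projection S : submod_closed [in S] -> forall x, exists p,
  (forall e : R, 0 < e -> exists2 y, S y & N (p - y) < e) /\
  forall y, S y -> rdot (x - p) y = 0.
Proof.
move=> Slin x; pose E := [set N (x - y) | y in S]; pose d := inf E.
have lbE : has_lbound E by exists 0 => _ [y _ <-]; exact: sqnorm_ge0.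
have d_le y : S y -> d <= N (x - y) by move=> Sy; apply: ge_inf => //; exists y.
have infE : has_inf E by split=> //; exists (N (x - 0)), 0 => //; exact: submod0.
have /choice[u uP] n : exists y, S y /\ N (x - y) < d + n.+1%:R^-1.
  have [_ [y Sy <-] ltd] := @inf_adherent _ E n.+1%:R^-1 ltac:(by []) infE.
  by exists y.
have cau n m : N (u n - u m) <= 2 * (n.+1%:R^-1 + m.+1%:R^-1).
  have [Sn ltn] := uP n; have [Sm ltm] := uP m.
  have := d_le _ (submodZ (scalar_of_real s 2^-1) Slin (submodD Slin Sn Sm)).
  rewrite -/(rscale _ _); set mid := _ *:% _ => d_mid.
  have -> : N (u n - u m) =
      2 * N (x - u n) + 2 * N (x - u m) - 4 * N (x - mid).
    rewrite /mid /N !rdotE (rdotC (u m) x) (rdotC (u n) x) (rdotC (u m) (u n)).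
    by field.
  by move: (n.+1%:R^-1) (m.+1%:R^-1) ltn ltm => *; lra.
have [p pP] := sqnorm_complete cau; exists p; split=> [e /pP[n0 near_p]|y Sy].
  by exists (u n0); [case: (uP n0) | exact: near_p].
apply: contrapT => /eqP; rewrite -sqrf_eq0 => nz.
have [y0|/eqP/sqnorm_gt0 Ny] := eqVneq y 0.
  by move: nz; rewrite y0 rdot0r expr0n eqxx.
set b := _ ^+ 2 in nz; have b0 : 0 < b by rewrite lt_def nz sqr_ge0.
have e0 : 0 < b / (4 * N y) by rewrite divr_gt0// mulr_gt0.
have [n1 small1] := invn_small ler01 e0; have [n2 small2] := pP _ e0.
pose n := maxn n1 n2.
have {small1} := small1 n (leq_maxl _ _); have {small2} := small2 n (leq_maxr _ _).
rewrite !ltr_pdivlMr ?mulr_gt0// mul1r => small2 small1.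
have [Sn ltn] := uP n; pose c := rdot (x - u n) y.
(* The minimality of d is tested at the best multiple of y. *)
have c_le : c ^+ 2 <= N y * n.+1%:R^-1.
  have := d_le _ (submodD Slin Sn (submodZ (scalar_of_real s (c / N y)) Slin Sy)).
  have -> : N (x - (u n + (c / N y) *:% y)) = N (x - u n) - c ^+ 2 / N y.
    rewrite opprD addrA /c /N !rdotE (rdotC y x) (rdotC y (u n)) (rdotC (u n) x).
    by field; rewrite -/(N y) gt_eqF.
  rewrite -ler_pdivrMl// [_^-1 * _]mulrC.
  by move: (n.+1%:R^-1) (_ / _) ltn => *; lra.
have b_le : b <= 2 * (c ^+ 2 + N (p - u n) * N y).
  apply: le_trans (_ : 2 * (c ^+ 2 + rdot (p - u n) y ^+ 2) <= _); last first.
    by rewrite ler_pM2l// lerD2l rdot_sqr_le.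
  have -> : b = (c - rdot (p - u n) y) ^+ 2.
    by rewrite /b /c -rdotBl opprB addrA subrK.
  by have := sqr_ge0 (c + rdot (p - u n) y); lra.
have : b < b.
  by apply: le_lt_trans b_le _; move: (n.+1%:R^-1) small1 c_le => *; lra.
by rewrite ltxx.
Qed.

Lemma rdot_closure0 S x z : (forall y, S y -> rdot z y = 0) ->
  (forall e : R, 0 < e -> exists2 y, S y & N (x - y) < e) -> rdot z x = 0.
Proof.
move=> zS xS; apply: contrapT => /eqP; rewrite -sqrf_eq0 => nz.
have b0 : 0 < rdot z x ^+ 2 by rewrite lt_def nz sqr_ge0.
have [y Sy] := xS _ (divr_gt0 b0 (ltr_wpDl (sqnorm_ge0 z) ltr01)).
rewrite ltr_pdivlMr ?ltr_wpDl ?sqnorm_ge0// mulrDr mulr1 => lt_b.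
have := rdot_sqr_le z (x - y); rewrite rdotBr (zS y)// subr0 mulrC => le_b.
by have := sqnorm_ge0 (x - y); lra.
Qed.

(** Multiplying y by the scalar <z, y> turns the inner product into |<z, y>|^2,
    so a vanishing real part already forces <z, y> = 0. *)
Lemma rdot_hdot0 S z : submod_closed [in S] -> (forall y, S y -> rdot z y = 0) ->
  forall y, S y -> hdot H z y = 0.
Proof.
move=> Slin zS y Sy; have := zS _ (submodZ (hdot H z y) Slin Sy).
rewrite /rdot linearZr_LR /= mulrC; exact: scalar_mul_conj_eq0.
Qed.

Lemma orth_projP F x : is_subspace F ->
  F (orth_proj F x) /\ forall y, F y -> hdot H (x - orth_proj F x) y = 0.
Proof.
move=> [Flin Fcl]; have [p [pF px]] := approx_projection Flin x.
have : exists q, [set q | F q /\ forall y, F y -> hdot H (x - q) y = 0] q.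
  exists p; split; first exact: closed_sqnorm Fcl pF.
  exact: rdot_hdot0 Flin px.
by move=> /getPex.
Qed.

Lemma orth_proj_in F x : is_subspace F -> F (orth_proj F x).
Proof. by move=> /(orth_projP x)[]. Qed.

Lemma orth_proj_hdot F x y : is_subspace F -> F y ->
  hdot H (x - orth_proj F x) y = 0.
Proof. by move=> /(orth_projP x)[_]; apply. Qed.

Lemma orth_proj_rdot F x y : is_subspace F -> F y ->
  rdot (x - orth_proj F x) y = 0.
Proof.
by move=> Fs Fy; rewrite /rdot orth_proj_hdot// -(scalar_of_real0 R s) scalar_re_real.
Qed.

Lemma rdot_proj F x y : is_subspace F -> F y -> rdot (orth_proj F x) y = rdot x y.
Proof. by move=> Fs /(orth_proj_rdot x Fs)/eqP; rewrite rdotBl subr_eq0 => /eqP. Qed.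

Lemma orth_proj_unique F x p : is_subspace F -> F p ->
  (forall y, F y -> hdot H (x - p) y = 0) -> orth_proj F x = p.
Proof.
move=> Fs Fp px; apply/eqP; rewrite -subr_eq0 -sqnorm_eq0 /sqnorm.
set q := orth_proj F x; have Fd : F (q - p).
  by apply: submodB => //; [case: Fs | exact: orth_proj_in].
have {1}-> : q - p = - (x - q) + (x - p) by rewrite opprB addrA subrK.
rewrite rdotDl rdotNl orth_proj_rdot//.
by rewrite /rdot px// -(scalar_of_real0 R s) scalar_re_real addr0 oppr0.
Qed.

Lemma orth_proj_lin F a x y : is_subspace F ->
  orth_proj F (a *: x + y) = a *: orth_proj F x + orth_proj F y.
Proof.
move=> Fs; apply: orth_proj_unique => // [|z Fz].
  by apply: submod_comb; [case: Fs | exact: orth_proj_in | exact: orth_proj_in].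
by rewrite opprD addrACA -scalerBr linearPl /= !orth_proj_hdot// mulr0 addr0.
Qed.

Lemma orth_proj_id F x : is_subspace F -> F x -> orth_proj F x = x.
Proof. by move=> Fs Fx; apply: orth_proj_unique => // y _; rewrite subrr linear0l. Qed.

Lemma sqnorm_proj F x : is_subspace F ->
  N x = N (orth_proj F x) + N (x - orth_proj F x).
Proof.
move=> Fs; have := orth_proj_rdot x Fs (orth_proj_in x Fs).
by rewrite /N !rdotE (rdotC _ x); lra.
Qed.

Lemma sqnorm_proj_le F x : is_subspace F -> N (orth_proj F x) <= N x.
Proof. by move=> Fs; rewrite [leRHS](sqnorm_proj x Fs) lerDl sqnorm_ge0. Qed.

End Projection.

(** * Symmetric operators on a closed subspace *)

Section SymmetricOperators.
Variables (R : realType) (s : scalars) (H : hilbertType R s).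
Local Notation K := (scalar_field R s).
Implicit Types (x y z f g : H) (r t e : R) (a : K) (B C D : H -> H).

(** Values outside F are irrelevant, as for [bounded_operator_on]. *)
Record sym_op (F : set H) B : Prop := SymOp {
  sym_in : forall x, F x -> F (B x);
  sym_lin : forall a x y, F x -> F y -> B (a *: x + y) = a *: B x + B y;
  sym_adj : forall x y, F x -> F y -> rdot (B x) y = rdot x (B y);
  sym_bdd : exists2 c : R, 0 < c & forall x, F x -> N (B x) <= c * N x }.

(** The negation of being bounded below on F: 0 is an approximate eigenvalue. *)
Definition approx_null (F : set H) B :=
  forall e, 0 < e -> exists2 f, F f & N (B f) < e * N f.

Lemma approx_nullPn (F : set H) B : ~ approx_null F B ->
  exists2 e, 0 < e & forall f, F f -> e * N f <= N (B f).
Proof.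
move=> nB; apply: contrapT => h; apply: nB => e e0; apply: contrapT => h2.
apply: h; exists e => // f Ff; rewrite leNgt; apply/negP => lt_f.
by apply: h2; exists f.
Qed.

Variable F : set H.
Hypothesis Fsub : is_subspace F.
Let Flin : submod_closed [in F] := proj1 Fsub.
Let F0 : F 0 := submod0 Flin.

Lemma sym0 B : sym_op F B -> B 0 = 0.
Proof.
move=> oB; have := sym_lin oB 1 F0 F0; rewrite !scale1r addr0.
by move=> /eqP; rewrite -subr_eq0 opprD addNKr oppr_eq0 => /eqP.
Qed.

Lemma symZ B r x : sym_op F B -> F x -> B (r *:% x) = r *:% B x.
Proof.
by move=> oB Fx; have := sym_lin oB (scalar_of_real s r) Fx F0; rewrite (sym0 oB) !addr0.
Qed.

Lemma symD B x y : sym_op F B -> F x -> F y -> B (x + y) = B x + B y.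
Proof. by move=> oB Fx Fy; have := sym_lin oB 1 Fx Fy; rewrite !scale1r. Qed.

Lemma symB B x y : sym_op F B -> F x -> F y -> B (x - y) = B x - B y.
Proof.
move=> oB Fx Fy; have := sym_lin oB (-1) Fy Fx.
by rewrite !scaleN1r ![- _ + _]addrC.
Qed.

Lemma rscale_comb r a x y : r *:% (a *: x + y) = a *: (r *:% x) + r *:% y.
Proof. by rewrite /rscale scalerDr !scalerA (mulrC a). Qed.

Lemma sqnormZ r x : N (r *:% x) = r ^+ 2 * N x.
Proof. by rewrite /N !rdotE mulrA. Qed.

Lemma sym_op_shift B r : sym_op F B -> sym_op F (fun x => B x - r *:% x).
Proof.
move=> oB; split=> [x Fx|a x y Fx Fy|x y Fx Fy|].
- by apply: submodB => //; [exact: (sym_in oB) | exact: submodZ].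
- by rewrite (sym_lin oB)// rscale_comb scalerBr opprD addrACA.
- by rewrite !rdotE (sym_adj oB).
have [c c0 cB] := sym_bdd oB; exists (2 * (c + r ^+ 2)) => [|x Fx].
  by rewrite mulr_gt0// ltr_wpDr ?sqr_ge0.
apply: le_trans (sqnormD_le _ _) _; rewrite sqnormN sqnormZ.
by have := cB x Fx; lra.
Qed.

Lemma sym_op_compl B : sym_op F B -> sym_op F (fun x => x - B x).
Proof.
move=> oB; split=> [x Fx|a x y Fx Fy|x y Fx Fy|].
- by apply: submodB => //; exact: (sym_in oB).
- by rewrite (sym_lin oB)// scalerBr opprD addrACA.
- by rewrite !rdotE (sym_adj oB).
have [c c0 cB] := sym_bdd oB; exists (2 * (1 + c)) => [|x Fx].
  by rewrite mulr_gt0// addr_gt0.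
apply: le_trans (sqnormD_le _ _) _; rewrite sqnormN.
by have := cB x Fx; lra.
Qed.

Lemma sym_op_sqr B : sym_op F B -> sym_op F (fun x => B (B x)).
Proof.
move=> oB; have FB x : F x -> F (B x) by exact: (sym_in oB).
split=> [x Fx|a x y Fx Fy|x y Fx Fy|].
- exact: FB (FB x Fx).
- by rewrite !(sym_lin oB)//; exact: FB.
- by rewrite !(sym_adj oB)//; exact: FB.
have [c c0 cB] := sym_bdd oB; exists (c * c) => [|x Fx]; first exact: mulr_gt0.
by apply: le_trans (cB _ (FB _ Fx)) _; rewrite -mulrA ler_pM2l// cB.
Qed.

(** For a symmetric operator the orthogonal complement of the range is the
    kernel. *)
Lemma dense_range C f : sym_op F C -> F f ->
  (forall z, F z -> C z = 0 -> rdot f z = 0) ->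
  forall e, 0 < e -> exists2 g, F g & N (f - C g) < e.
Proof.
move=> oC Ff f_ker; pose S := [set C g | g in F].
have Slin : submod_closed [in S].
  split=> [|a _ _ /set_mem[x Fx <-] /set_mem[y Fy <-]]; rewrite inE.
    by exists 0 => //; exact: sym0.
  by exists (a *: x + y); [exact: submod_comb | rewrite (sym_lin oC)].
have [p [pS fp]] := approx_projection Slin f.
have SF y : S y -> F y by move=> [x Fx <-]; exact: (sym_in oC).
have Fp : F p.
  apply: closed_sqnorm (proj2 Fsub) _ => e /pS[y /SF]; by exists y.
have Fz : F (f - p) by exact: submodB.
have Cz : C (f - p) = 0.
  have FC := sym_in oC Fz.
  apply/eqP; rewrite -sqnorm_eq0 /N (sym_adj oC)//; apply/eqP/fp.
  by exists (C (f - p)).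
have /eqP : N (f - p) = 0.
  by rewrite /N rdotBr (rdot_closure0 fp pS) subr0 rdotC f_ker.
rewrite sqnorm_eq0 subr_eq0 => /eqP -> e /pS[_ [g Fg <-]].
by exists g.
Qed.

(** Bounded below: the kernel is trivial, so the range is dense, and preimages
    of a convergent sequence converge, so it is closed. *)
Lemma bounded_below_onto B e : sym_op F B -> 0 < e ->
  (forall f, F f -> e * N f <= N (B f)) ->
  forall f, F f -> exists2 g, F g & B g = f.
Proof.
move=> oB e0 bB f Ff.
have ker z : F z -> B z = 0 -> rdot f z = 0.
  move=> Fz Bz; have := bB z Fz; rewrite Bz sqnorm0 pmulr_rle0// => z0.
  have /eqP : N z = 0 by apply/le_anti; rewrite z0 sqnorm_ge0.
  by rewrite sqnorm_eq0 => /eqP ->; rewrite rdot0r.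
have /choice[u uP] (n : nat) : exists g, F g /\ N (f - B g) < n.+1%:R^-1.
  have [g Fg ltg] := @dense_range B f oB Ff ker n.+1%:R^-1 ltac:(by []).
  by exists g.
have Fu n : F (u n) := proj1 (uP n).
have cau n m : N (u n - u m) <= 2 / e * (n.+1%:R^-1 + m.+1%:R^-1).
  rewrite mulrAC ler_pdivlMr// mulrC.
  apply: le_trans (bB _ (submodB Flin (Fu n) (Fu m))) _; rewrite (symB oB)//.
  have -> : B (u n) - B (u m) = (B (u n) - f) + (f - B (u m)).
    by rewrite addrA subrK.
  apply: le_trans (sqnormD_le _ _) _; rewrite ler_pM2l// lerD// ?(sqnormBC _ f);
  by apply/ltW; case: (uP n); case: (uP m).
have [g ug] := sqnorm_complete cau.
have Fg : F g.
  apply: closed_sqnorm (proj2 Fsub) _ => d /ug[n0 /(_ n0 (leqnn _)) ?].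
  by exists (u n0).
exists g => //; have [c c0 cB] := sym_bdd oB.
have le_d d : 0 < d -> N (B g - f) <= d.
  move=> d0; have d4 : 0 < d / 4 by rewrite divr_gt0.
  have [n1 h1] := ug _ (divr_gt0 d4 c0); have [n2 h2] := invn_small ler01 d4.
  pose n := maxn n1 n2; have {h1} := h1 n (leq_maxl _ _); rewrite ltr_pdivlMr// => h1.
  have {h2} := h2 n (leq_maxr _ _); rewrite mul1r => h2.
  have -> : B g - f = B (g - u n) + (B (u n) - f) by rewrite (symB oB)// addrA subrK.
  apply: le_trans (sqnormD_le _ _) _; rewrite (sqnormBC _ f).
  have := cB _ (submodB Flin Fg (Fu n)); have [_] := uP n.
  by move: (n.+1%:R^-1) h2 => *; lra.
apply/eqP; rewrite -subr_eq0 -sqnorm_eq0; apply/eqP/le_anti.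
by rewrite sqnorm_ge0 andbT; apply/ler_addgt0Pl => d d0; rewrite addr0 le_d.
Qed.

(** A bounded inverse is exactly what being bounded below provides. *)
Lemma spectrum_approx_null (T : H -> H) r : sym_op F T ->
  spectrum_on F T (scalar_of_real s r) <-> approx_null F (fun x => T x - r *:% x).
Proof.
move=> oT; set B := fun x => _; have oB : sym_op F B by exact: sym_op_shift.
split=> [sp|apB].
  apply: contrapT => /approx_nullPn[e e0 bB]; apply: sp.
  have onto := bounded_below_onto oB e0 bB.
  have /choice[U UP] x : exists y, F x -> F y /\ B y = x.
    have [Fx|nFx] := pselect (F x); last by exists x.
    by have [y Fy By] := onto x Fx; exists y.
  have inj x y : F x -> F y -> B x = B y -> x = y.
    move=> Fx Fy Bxy; apply/eqP; rewrite -subr_eq0 -sqnorm_eq0; apply/eqP/le_anti.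
    rewrite sqnorm_ge0 andbT -(pmulr_rle0 _ e0).
    by apply: le_trans (bB _ (submodB Flin Fx Fy)) _; rewrite (symB oB)// Bxy subrr sqnorm0.
  have FU x : F x -> F (U x) by move=> /UP[].
  have BU x : F x -> B (U x) = x by move=> /UP[].
  exists U; split; first split=> // [a x y Fx Fy|].
  - have Fxy := submod_comb a Flin Fx Fy.
    have FUxy := submod_comb a Flin (FU _ Fx) (FU _ Fy).
    by apply: inj => //; [exact: FU | rewrite BU// (sym_lin oB) ?BU//; exact: FU].
  - exists (scalar_of_real s (Num.sqrt e^-1)) => x Fx.
    rewrite -!hnormK -scalar_of_realM ler_scalar_of_real//.
    rewrite !hnormE -sqrtrM ?invr_ge0 ?(ltW e0)// ler_wsqrtr//.
    by rewrite ler_pdivlMl// -{2}(BU x Fx) bB//; exact: FU.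
  - move=> x Fx; have FBx := sym_in oB Fx; split; last exact: BU.
    by apply: inj => //; [exact: FU | exact: BU].
move=> [U [[FU Ulin [M UM]] UP]].
pose m := scalar_re M; have m0 : 0 < m ^+ 2 + 1 by rewrite ltr_wpDl ?sqr_ge0.
have [f Ff] := apB (m ^+ 2 + 1)^-1 ltac:(by rewrite invr_gt0).
rewrite ltr_pdivlMl// => lt_f.
have := UM _ (sym_in oB Ff); have [-> _] := UP f Ff => /ler_scalar_re.
rewrite -(hnormK (B f)) mulrC scalar_reZ -/(hnorm f) mulrC -/m => le_f.
have : N f <= m ^+ 2 * N (B f).
  rewrite !sqnormE -exprMn ler_pXn2r ?nnegrE ?hnorm_ge0//.
  exact: le_trans (hnorm_ge0 f) le_f.
by have := sqnorm_ge0 (B f); lra.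
Qed.

(** A weak form of the Cauchy-Schwarz inequality for the form <D x, y>: its
    positivity at c f - D f suffices. *)
Lemma positive_sqnorm_le D : sym_op F D -> (forall f, F f -> 0 <= rdot (D f) f) ->
  exists2 c, 0 < c & forall f, F f -> N (D f) <= c * rdot (D f) f.
Proof.
move=> oD D0; have [k k0 kD] := sym_bdd oD.
pose c := (k + 1) / 2; have c0 : 0 < c by rewrite divr_gt0// addr_gt0.
exists c => // f Ff; have FDf := sym_in oD Ff.
have DD_le : rdot (D (D f)) (D f) <= c * N (D f).
  have := kD _ FDf; have := sqnorm_ge0 (D (D f) - D f).
  by rewrite {1}/N !rdotE (rdotC (D f)) -!/(N _) /c; lra.
have Fg : F (c *:% f - D f) by apply: submodB => //; exact: submodZ.
have := D0 _ Fg; rewrite (symB oD)//; last exact: submodZ.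
rewrite (symZ _ oD)// !rdotE (sym_adj oD FDf Ff) -!/(N _) => pos.
have : 0 <= c * (c * rdot (D f) f - N (D f)) by move: pos DD_le; nra.
by rewrite pmulr_rge0// subr_ge0.
Qed.

(** The infimum b of <B^2 f, f> over unit vectors is an approximate eigenvalue
    of B^2. As B^2 - b is the product of B - r and B + r with r^2 = b, one of
    r and - r is an approximate eigenvalue of B, so r cannot be below a. *)
Lemma spectral_gap B (a : R) : sym_op F B -> 0 < a ->
  (forall r, - a < r < a -> ~ approx_null F (fun x => B x - r *:% x)) ->
  forall f, F f -> a ^+ 2 * N f <= N (B f).
Proof.
move=> oB a0 gap; apply: contrapT => /existsNP[f0 /not_implyP[Ff0 /negP]].
rewrite -ltNge => lt_f0.
have FB f : F f -> F (B f) by exact: (sym_in oB).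
pose E := [set N (B f) / N f | f in [set f | F f /\ f <> 0]]; pose b := inf E.
have f00 : f0 <> 0.
  by move=> f00; move: lt_f0; rewrite f00 (sym0 oB) !sqnorm0 mulr0 ltxx.
have Ef0 : E (N (B f0) / N f0) by exists f0.
have lbE : lbound E 0.
  by move=> _ [f _ <-]; rewrite divr_ge0 ?sqnorm_ge0.
have infE : has_inf E by split; [exists (N (B f0) / N f0) | exists 0].
have b0 : 0 <= b by apply: lb_le_inf => //; exists (N (B f0) / N f0).
have b_le f : F f -> b * N f <= N (B f).
  move=> Ff; have [->|/eqP f0'] := eqVneq f 0; first by rewrite sqnorm0 mulr0 sqnorm_ge0.
  rewrite -ler_pdivlMr ?sqnorm_gt0//; apply: ge_inf; first by exists 0.
  by exists f.
have lt_b : b < a ^+ 2.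
  apply: le_lt_trans (_ : N (B f0) / N f0 < _); first by apply: ge_inf => //; exists 0.
  by rewrite ltr_pdivrMr ?sqnorm_gt0.
pose r := Num.sqrt b; have r0 : 0 <= r by exact: sqrtr_ge0.
have r2 : r ^+ 2 = b by rewrite sqr_sqrtr.
have ra : r < a by rewrite -(@ltr_pXn2r _ 2%N) ?nnegrE ?r2// ltW.
have [e1 e10 h1] := approx_nullPn (gap r ltac:(lra)).
have [e2 e20 h2] := approx_nullPn (gap (- r) ltac:(lra)).
pose D x := B (B x) - b *:% x.
have oD : sym_op F D by apply: sym_op_shift; exact: sym_op_sqr.
have rdotD f : F f -> rdot (D f) f = N (B f) - b * N f.
  by move=> Ff; rewrite /D rdotBl rdotZl (sym_adj oB)//; exact: FB.
have D0 f : F f -> 0 <= rdot (D f) f.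
  by move=> Ff; rewrite rdotD// subr_ge0 b_le.
have [c c0 cD] := positive_sqnorm_le oD D0.
have D_ge f : F f -> e1 * e2 * N f <= N (D f).
  move=> Ff; pose g := B f - (- r) *:% f.
  have Fg : F g by exact: (sym_in (sym_op_shift (- r) oB)).
  have -> : D f = B g - r *:% g.
    rewrite /g (symB oB) ?(symZ _ oB)//; [|exact: FB|exact: submodZ].
    rewrite /D -r2 expr2 /rscale !scalar_of_realN scalar_of_realM.
    by rewrite !scaleNr !opprK scalerDr scalerA opprD addrA addrK.
  by apply: le_trans (h1 g Fg); rewrite -mulrA ler_pM2l// h2.
have gap_f f : F f -> (b + e1 * e2 / c) * N f <= N (B f).
  move=> Ff; have := le_trans (D_ge f Ff) (cD f Ff); rewrite rdotD// => h.
  by rewrite mulrDl addrC -lerBrDr mulrAC ler_pdivrMr// (mulrC (_ - _)).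
(* B^2 - b is bounded below, which contradicts the choice of b. *)
have : b + e1 * e2 / c <= b.
  apply: lb_le_inf; first by exists (N (B f0) / N f0).
  by move=> _ [f [Ff /sqnorm_gt0 f1] <-]; rewrite ler_pdivlMr// gap_f.
by rewrite gerDl leNgt divr_gt0// mulr_gt0.
Qed.

(** C^2 >= e C forces C >= e off the kernel. For f = C g in the range this
    follows from the positivity of C at e g - C g, and the range is dense in the
    orthogonal complement of the kernel. *)
Lemma square_gap C e : sym_op F C -> 0 < e ->
  (forall f, F f -> 0 <= rdot (C f) f) ->
  (forall f, F f -> e * rdot (C f) f <= N (C f)) ->
  forall f, F f -> (forall z, F z -> C z = 0 -> rdot f z = 0) ->
  e * N f <= rdot (C f) f.
Proof.
move=> oC e0 C0 C2 f Ff f_ker; have FC g : F g -> F (C g) by exact: (sym_in oC).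
pose D x := C x - e *:% x; have oD : sym_op F D by exact: sym_op_shift.
have range g : F g -> 0 <= rdot (D (C g)) (C g).
  move=> Fg; have FCg := FC g Fg.
  have Fh : F (e *:% g - C g) by apply: submodB => //; exact: submodZ.
  have := C0 _ Fh; rewrite (symB oC)//; last exact: submodZ.
  rewrite (symZ _ oC)// !rdotE (sym_adj oC FCg Fg) -!/(N _) => pos.
  have := C2 g Fg; rewrite -(ler_pM2l e0) => h.
  by rewrite /N; move: pos h; rewrite /N; lra.
suff : 0 <= rdot (D f) f by rewrite /D !rdotE subr_ge0.
clearbody D; rewrite leNgt; apply/negP => neg; set b := rdot _ _ in neg.
(* Were the form of D = C - e equal to b < 0 at f, a vector of the range close
   enough to f would make it negative too. By a weighted inequality between
   arithmetic and geometric means, the error linear in f - C g splits into a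
   fixed part, which t keeps below - b / 2, and a multiple of |f - C g|^2,
   whose smallness is prescribed by m. *)
have [k k0 kD] := sym_bdd oD; pose n := N (D f) + 1.
have n0 : 0 < n by rewrite ltr_wpDl ?sqnorm_ge0.
pose t := - b / (2 * n); have t0 : 0 < t by rewrite divr_gt0 ?mulr_gt0// oppr_gt0.
pose m := t^-1 + (k + 1) / 2.
have m0 : 0 < m by rewrite addr_gt0 ?invr_gt0// divr_gt0// addr_gt0.
have d0 : 0 < - b / 2 / m by rewrite !divr_gt0// oppr_gt0.
have [g Fg] := dense_range oC Ff f_ker d0.
rewrite ltr_pdivlMr//; set u := f - C g => lt_u.
have FCg := FC g Fg; have Fu : F u by exact: submodB.
have := range g Fg; have -> : C g = f - u by rewrite opprB addrC subrK.
clearbody u.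
rewrite (symB oD)// !rdotE -/b (sym_adj oD Fu Ff) (rdotC u).
have amgm : - (2 * rdot (D f) u) <= t * N (D f) + N u / t.
  have := sqnorm_ge0 (t *:% D f + u); rewrite {1}/N !rdotE (rdotC u) -!/(N _) => h.
  rewrite -(ler_pM2l t0).
  have -> : t * (t * N (D f) + N u / t) = t * t * N (D f) + N u.
    by field; rewrite gt_eqF.
  lra.
have tn : t * N (D f) <= - b / 2.
  rewrite /t mulrAC ler_pdivrMr ?mulr_gt0// /n.
  by have := sqnorm_ge0 (D f); nra.
have uD : rdot (D u) u <= (k + 1) / 2 * N u.
  have := kD _ Fu; have := sqnorm_ge0 (D u - u).
  by rewrite {1}/N !rdotE (rdotC u) -!/(N _); lra.
by move: lt_u; rewrite /m mulrDr; move: (_ / t) amgm => *; lra.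
Qed.

End SymmetricOperators.

(** * Products of two projections *)

Section TwoSubspaces.
Variables (R : realType) (s : scalars) (H : hilbertType R s).
Implicit Types (F G : set H) (f g x y z : H) (c e l : R).
Local Notation proj_comp F G := (orth_proj F \o orth_proj G).

(** This says that dist(f, G)^2 >= c dist(f, M)^2 for all f in F, where M is the
    intersection of F and G; only f orthogonal to M matter. *)
Definition gap_bound F G c := forall f, F f ->
  (forall z, F z -> G z -> rdot f z = 0) -> c * N f <= N (f - orth_proj G f).

Lemma is_subspaceI F G : is_subspace F -> is_subspace G -> is_subspace (F `&` G).
Proof.
move=> [linF clF] [linG clG]; split; last exact: closedI.
split=> [|a x y /set_mem[Fx Gx] /set_mem[Fy Gy]]; rewrite inE.
  by split; exact: submod0.
by split; exact: submod_comb.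
Qed.

Lemma rdot_proj2 G x y : is_subspace G ->
  rdot (orth_proj G x) y = rdot (orth_proj G x) (orth_proj G y).
Proof. by move=> sG; rewrite rdotC [RHS]rdotC rdot_proj//; exact: orth_proj_in. Qed.

Lemma proj_comp_adj F G x y : is_subspace F -> is_subspace G -> F y ->
  rdot (proj_comp F G x) y = rdot (orth_proj G x) (orth_proj G y).
Proof. by move=> sF sG Fy /=; rewrite rdot_proj// rdot_proj2. Qed.

Lemma sym_op_proj_comp F G : is_subspace F -> is_subspace G ->
  sym_op F (proj_comp F G).
Proof.
move=> sF sG; split=> [x Fx|a x y Fx Fy|x y Fx Fy|].
- exact: orth_proj_in.
- by rewrite /= !orth_proj_lin.
- by rewrite (rdotC x) !proj_comp_adj// rdotC.
exists 1 => // x _; rewrite mul1r.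
exact: le_trans (sqnorm_proj_le _ sF) (sqnorm_proj_le _ sG).
Qed.

(** The form of 1 - P_F P_G on F is the squared distance to G. *)
Lemma rdot_compl_proj_comp F G f : is_subspace F -> is_subspace G -> F f ->
  rdot (f - proj_comp F G f) f = N (f - orth_proj G f).
Proof.
move=> sF sG Ff; rewrite rdotBl proj_comp_adj// -!/(N _).
by rewrite [N f](sqnorm_proj f sG) [_ + N (f - _)]addrC addrK.
Qed.

Lemma proj_comp_fixed F G z : is_subspace F -> is_subspace G -> F z -> G z ->
  proj_comp F G z = z.
Proof. by move=> sF sG Fz Gz /=; rewrite (orth_proj_id sG)// orth_proj_id. Qed.

Lemma proj_comp_ker F G z : is_subspace F -> is_subspace G -> F z ->
  z - proj_comp F G z = 0 -> G z.
Proof.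
move=> sF sG Fz Cz; have := rdot_compl_proj_comp sF sG Fz.
rewrite Cz rdotC rdot0r => /esym/eqP; rewrite sqnorm_eq0 subr_eq0 => /eqP ->.
exact: orth_proj_in.
Qed.

(** T - l acts as 1 - l on M, and as an operator with form at most 1 - c - l on
    the orthogonal complement of M in F, which T preserves. If l > 1 - c both
    parts are bounded below. *)
Lemma gap_bound_spectrum F G c l : is_subspace F -> is_subspace G ->
  gap_bound F G c -> approx_null F (fun x => proj_comp F G x - l *:% x) ->
  l <> 1 -> l <= 1 - c.
Proof.
move=> sF sG gapc ap /eqP l1; rewrite leNgt; apply/negP => lt_l.
have sM := is_subspaceI sF sG; have linF := proj1 sF.
pose T := proj_comp F G; have oT : sym_op F T := sym_op_proj_comp sF sG.
pose d := c - (1 - l); have d0 : 0 < d by rewrite /d; lra.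
have l0 : 0 < (1 - l) ^+ 2 by rewrite exprn_even_gt0//= subr_eq0 eq_sym.
have [f Ff] := ap (Num.min ((1 - l) ^+ 2) (d ^+ 2)) ltac:(by rewrite lt_min l0 exprn_gt0).
pose f0 := orth_proj (F `&` G) f; pose f1 := f - f0.
have [Ff0 Gf0] : (F `&` G) f0 by exact: orth_proj_in.
have Ff1 : F f1 by exact: submodB.
have f1M z : F z -> G z -> rdot f1 z = 0 by move=> Fz Gz; exact: orth_proj_rdot.
pose g := T f1 - l *:% f1.
have f0g : rdot f0 g = 0.
  by rewrite /g rdotBr rdotZr -(sym_adj oT)// /T proj_comp_fixed// rdotC f1M// mulr0 subr0.
have -> : T f - l *:% f = (1 - l) *:% f0 + g.
  have {1 2}-> : f = f0 + f1 by rewrite /f1 addrC subrK.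
  rewrite (symD oT)// {1}/T proj_comp_fixed// /g /rscale scalerDr.
  by rewrite scalar_of_realD scalar_of_realN scalar_of_real1 scalerBl scale1r opprD addrACA.
have -> : N ((1 - l) *:% f0 + g) = (1 - l) ^+ 2 * N f0 + N g.
  by clearbody g; rewrite /N !rdotE (rdotC g) f0g; ring.
rewrite (sqnorm_proj f sM) -/f0 -/f1 => lt_N.
have g_ge : d ^+ 2 * N f1 <= N g.
  have le_g : rdot g f1 <= - d * N f1.
    have := gapc _ Ff1 f1M; rewrite /g rdotBl rdotZl proj_comp_adj// -!/(N _).
    by have := sqnorm_proj f1 sG; rewrite /d; lra.
  have := sqnorm_ge0 (g + d *:% f1); clearbody g f1.
  rewrite {1}/N !rdotE (rdotC f1) -!/(N _) => g_pos.
  by move: (ler_wpM2l (ltW d0) le_g); lra.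
set m := Num.min _ _ in lt_N.
have m1 : m <= (1 - l) ^+ 2 by rewrite ge_min lexx.
have m2 : m <= d ^+ 2 by rewrite ge_min lexx orbT.
have := ler_wpM2r (sqnorm_ge0 f0) m1; have := ler_wpM2r (sqnorm_ge0 f1) m2.
by lra.
Qed.

(** The converse: with a = e/2, the operator 1 - T - a has no spectral value in
    ]- a, a[, and (1 - T - a)^2 >= a^2 expands to (1 - T)^2 >= e (1 - T). *)
Lemma spectrum_gap_bound F G e : is_subspace F -> is_subspace G -> 0 < e ->
  (forall l, 1 - e < l < 1 ->
    ~ approx_null F (fun x => proj_comp F G x - l *:% x)) ->
  gap_bound F G e.
Proof.
move=> sF sG e0 gap f Ff fM; pose T := proj_comp F G.
have oC := sym_op_compl sF (sym_op_proj_comp sF sG).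
have formC f' : F f' -> _ := rdot_compl_proj_comp sF sG (f := f').
rewrite -formC//; apply: (square_gap sF oC e0) => // [g Fg|g Fg|z Fz Cz].
- by rewrite formC// sqnorm_ge0.
- pose a := e / 2; have a0 : 0 < a by rewrite divr_gt0.
  have := spectral_gap sF (sym_op_shift sF a oC) a0 _ Fg.
  have gap_a r : - a < r < a ->
      ~ approx_null F (fun x => x - T x - a *:% x - r *:% x).
    move=> ra ap; apply: (gap (1 - a - r)); first by rewrite /a in ra *; lra.
    move=> d /ap[h Fh lt_h]; exists h => //.
    rewrite sqnormBC /rscale !scalar_of_realD !scalar_of_realN scalar_of_real1.
    rewrite !scalerDl !scaleNr scale1r addrAC (addrAC h).
    exact: lt_h.
  move=> /(_ gap_a); set Cg := g - _; clearbody Cg.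
  rewrite {2}/N !rdotE (rdotC g) -!/(N _) /a; lra.
by apply: fM => //; exact: proj_comp_ker Cz.
Qed.

(** P_G intertwines P_F P_G with P_G P_F. As |P_G f|^2 = <T f, f>, which is about
    l |f|^2 for an approximate eigenvector f, its image P_G f is not too small
    when l > 0. *)
Lemma approx_null_swap F G l : is_subspace F -> is_subspace G -> 0 < l ->
  approx_null F (fun x => proj_comp F G x - l *:% x) ->
  approx_null G (fun x => proj_comp G F x - l *:% x).
Proof.
move=> sF sG l0 ap e e0; pose d := Num.min (l ^+ 2 / 2) (e * (l / 4)).
have d0 : 0 < d by rewrite lt_min divr_gt0 ?exprn_gt0// mulr_gt0// divr_gt0.
have [f Ff] := ap d d0; set h := _ - _ => lt_h.
pose g := orth_proj G f; exists g; first exact: orth_proj_in.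
have -> : proj_comp G F g - l *:% g = orth_proj G h.
  have -> : h = (- scalar_of_real s l) *: f + proj_comp F G f.
    by rewrite scaleNr addrC.
  by rewrite orth_proj_lin// scaleNr addrC.
apply: le_lt_trans (sqnorm_proj_le _ sG) _.
have d1 : d <= l ^+ 2 / 2 by rewrite ge_min lexx.
have d2 : d <= e * (l / 4) by rewrite ge_min lexx orbT.
(* From the positivity of |h + l f|^2, where h = T f - l f is small. *)
have g_ge : l / 4 * N f <= N g.
  have hf : rdot h f = N g - l * N f.
    by rewrite /h rdotBl rdotZl proj_comp_adj.
  have := sqnorm_ge0 (h + l *:% f); clearbody h.
  rewrite {1}/N !rdotE (rdotC f h) hf -!/(N _) => pos.
  rewrite -(ler_pM2l l0); have := ler_wpM2r (sqnorm_ge0 f) d1. lra.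
apply: lt_le_trans lt_h _; apply: le_trans (ler_wpM2r (sqnorm_ge0 f) d2) _.
by rewrite -mulrA ler_pM2l.
Qed.

(** * The minimum gap *)

Lemma dist_proj S f : is_subspace S -> dist f S = hnorm (f - orth_proj S f).
Proof.
move=> sS; have Sp := orth_proj_in f sS.
have lbP : lbound [set hnorm (f - x) | x in S] (hnorm (f - orth_proj S f)).
  move=> _ [x Sx <-]; rewrite !hnormE ler_wsqrtr//.
  have -> : f - x = (f - orth_proj S f) + (orth_proj S f - x) by rewrite addrA subrK.
  set p := f - _; set q := _ - x.
  have pq : rdot p q = 0 by apply: orth_proj_rdot => //; apply: submodB => //; case: sS.
  have -> : N (p + q) = N p + N q.
    by clearbody p q; rewrite /N !rdotE (rdotC q) pq; ring.
  by rewrite lerDl sqnorm_ge0.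
apply/le_anti/andP; split.
  by apply: ge_inf; [exists (hnorm (f - orth_proj S f)) | exists (orth_proj S f)].
by apply: lb_le_inf => //; exists (hnorm (f - orth_proj S f)), (orth_proj S f).
Qed.

Section MinimumGap.
Variables F G : set H.
Hypotheses (sF : is_subspace F) (sG : is_subspace G) (nFG : ~ F `<=` G).
Let sM : is_subspace (F `&` G) := is_subspaceI sF sG.
Let ratios := [set dist f G / dist f (F `&` G) | f in F `\` G].

Lemma minimum_gapE : minimum_gap F G = inf ratios.
Proof. by rewrite /minimum_gap; case: asboolP. Qed.

(** The vector f1 is f minus its projection on F `&` G, on which P_G is the
    identity. *)
Lemma dist_capP f : F f -> ~ G f -> exists f1,
  [/\ F f1, forall z, F z -> G z -> rdot f1 z = 0, f1 <> 0,
      dist f (F `&` G) = hnorm f1 & dist f G = hnorm (f1 - orth_proj G f1)].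
Proof.
move=> Ff nGf; pose f0 := orth_proj (F `&` G) f; exists (f - f0).
have [Ff0 Gf0] : (F `&` G) f0 by exact: orth_proj_in.
split; [| | | exact: dist_proj |].
- by apply: submodB => //; case: sF.
- by move=> z Fz Gz; exact: orth_proj_rdot.
- by move=> /eqP; rewrite subr_eq0 => /eqP ff0; apply: nGf; rewrite ff0.
rewrite dist_proj//; congr hnorm.
have -> : f - f0 = (-1) *: f0 + f by rewrite scaleN1r addrC.
by rewrite orth_proj_lin// (orth_proj_id sG Gf0) !scaleN1r opprD opprK addrACA addNr add0r.
Qed.

Lemma ratios_neq0 : ratios !=set0.
Proof.
have [f /not_implyP[Ff nGf]] : exists f, ~ (F f -> G f) by exact/existsNP.
by exists (dist f G / dist f (F `&` G)), f.
Qed.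

Lemma ratios_ge0 : lbound ratios 0.
Proof.
by move=> _ [f [Ff nGf] <-]; rewrite !dist_proj// divr_ge0 ?hnorm_ge0.
Qed.

Lemma minimum_gap_ge0 : 0 <= minimum_gap F G.
Proof. by rewrite minimum_gapE; apply: lb_le_inf ratios_neq0 ratios_ge0. Qed.

Lemma minimum_gap_le1 : minimum_gap F G <= 1.
Proof.
rewrite minimum_gapE; have [_ [f [Ff nGf] _]] := ratios_neq0.
apply: le_trans (_ : dist f G / dist f (F `&` G) <= _).
  by apply: ge_inf; [exists 0; exact: ratios_ge0 | exists f].
have [f1 [_ _ /sqnorm_gt0 f1_gt0 -> ->]] := dist_capP Ff nGf.
rewrite !hnormE ler_pdivrMr ?sqrtr_gt0// mul1r ler_wsqrtr//.
by rewrite [leRHS](sqnorm_proj f1 sG) lerDr sqnorm_ge0.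
Qed.

Lemma gap_bound_minimum_gap : gap_bound F G (minimum_gap F G ^+ 2).
Proof.
move=> f Ff fM; have [->|/eqP f0] := eqVneq f 0.
  by rewrite sqnorm0 mulr0 sqnorm_ge0.
have nGf : ~ G f.
  by move=> Gf; have /eqP := fM f Ff Gf; rewrite -/(N f) sqnorm_eq0 => /eqP.
have Nf := sqnorm_gt0 f0.
have : minimum_gap F G <= dist f G / dist f (F `&` G).
  rewrite minimum_gapE; apply: ge_inf; last by exists f.
  by exists 0; exact: ratios_ge0.
have Pf : orth_proj (F `&` G) f = 0.
  apply: orth_proj_unique => // [|y My]; first by apply: submod0; case: sM.
  rewrite subr0; apply: (rdot_hdot0 (proj1 sM)) My => z [Fz Gz]; exact: fM.
rewrite !dist_proj// Pf subr0 ler_pdivlMr; last by rewrite hnormE sqrtr_gt0.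
by move=> le_f; rewrite !sqnormE -exprMn ler_pXn2r ?nnegrE ?mulr_ge0 ?hnorm_ge0 ?minimum_gap_ge0.
Qed.

Lemma le_minimum_gap c : 0 <= c -> gap_bound F G (c ^+ 2) -> c <= minimum_gap F G.
Proof.
move=> c0 gapc; rewrite minimum_gapE; apply: lb_le_inf ratios_neq0 _.
move=> _ [f [Ff nGf] <-]; have [f1 [Ff1 f1M f1_neq0 -> ->]] := dist_capP Ff nGf.
have f1_gt0 := sqnorm_gt0 f1_neq0.
rewrite ler_pdivlMr; last by rewrite hnormE sqrtr_gt0.
have := gapc f1 Ff1 f1M; rewrite !sqnormE -exprMn ler_pXn2r ?nnegrE ?mulr_ge0 ?hnorm_ge0//.
Qed.

End MinimumGap.

(** * Angles and approximate eigenvalues *)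

Lemma angle_cos F G c (t : R) : is_subspace F -> is_subspace G -> gap_bound F G c ->
  (angles_between F G `\ 0) t ->
  exists2 sigma, 0 <= sigma /\ t = acos sigma & sigma ^+ 2 <= 1 - c.
Proof.
move=> sF sG gapc [[[sigma [s0 sp] <-] _] t0]; exists sigma => //.
apply: (gap_bound_spectrum sF sG gapc).
  by apply/spectrum_approx_null => //; exact: sym_op_proj_comp.
move=> /eqP; rewrite sqrf_eq1 => /orP[] /eqP sE; last by move: s0; rewrite sE; lra.
by apply: t0; rewrite sE acos1.
Qed.

Lemma approx_null_angle F G l : is_subspace F -> is_subspace G -> 0 < l < 1 ->
  approx_null F (fun x => proj_comp F G x - l *:% x) ->
  (angles_between F G `\ 0) (acos (Num.sqrt l)).
Proof.
move=> sF sG /andP[l0 l1] ap.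
have sl : Num.sqrt l ^+ 2 = l by rewrite sqr_sqrtr// ltW.
have sl1 : Num.sqrt l < 1 by rewrite -(@ltr_pXn2r _ 2%N) ?nnegrE ?sqrtr_ge0// sl expr1n.
split; last first.
  by move=> /eqP; rewrite gt_eqF// acos_gt0// sl1 andbT (le_trans _ (sqrtr_ge0 l))// lerN10.
split; (exists (Num.sqrt l) => //; split; first exact: sqrtr_ge0); rewrite sl.
  by apply/spectrum_approx_null => //; exact: sym_op_proj_comp.
by apply/spectrum_approx_null => //; [exact: sym_op_proj_comp | exact: approx_null_swap].
Qed.

Lemma acos_le_pihalf (x : R) : 0 <= x <= 1 -> acos x <= pi / 2.
Proof.
move=> /andP[x0 x1]; have x_itv : -1 <= x <= 1 by rewrite x1 andbT (le_trans _ x0)// lerN10.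
have pi0 := pi_gt0 R.
have acos_itv : acos x \in `[0, pi] by rewrite in_itv/= acos_ge0// acos_lepi.
have pihalf_itv : pi / 2 \in `[0, pi : R] by rewrite in_itv/=; lra.
by rewrite leNgt -ltr_cos// acosK ?in_itv// cos_pihalf -leNgt.
Qed.

(** Thanks to the value pi/2 at the empty set, [angle_inf] is the infimum in
    [0, pi/2] of every subset of that interval. *)
Lemma angle_infP (A : set R) : A `<=` `[0, pi / 2] ->
  [/\ 0 <= angle_inf A <= pi / 2, forall t : R, A t -> angle_inf A <= t &
      forall x : R, x <= pi / 2 -> (forall t, A t -> x <= t) -> x <= angle_inf A].
Proof.
move=> A_itv; have pi0 := pi_gt0 R; rewrite /angle_inf; case: asboolP => [->|].
  by split=> //; lra.
move=> /eqP/set0P[t0 At0].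
have A0 t : A t -> 0 <= t <= pi / 2 by move=> /A_itv; rewrite /= in_itv.
have lbA : has_lbound A by exists 0 => t /A0/andP[].
have infA t : A t -> inf A <= t by move=> At; exact: ge_inf.
split=> // [|x _ xA]; last by apply: lb_le_inf; [exists t0 | exact: xA].
have /andP[_ t0_pi] := A0 _ At0.
rewrite (le_trans (infA _ At0) t0_pi) andbT; apply: lb_le_inf; first by exists t0.
by move=> t /A0/andP[].
Qed.

End TwoSubspaces.

Theorem theorem2p15 (R : realType) (s : scalars) (H : hilbertType R s)
    (F G : set H)
    (subF : is_subspace F) (subG : is_subspace G)
    (nontrivF : F <> [set 0]) (nontrivG : G <> [set 0])
    (properF : F <> setT) (properG : G <> setT) :
  minimum_gap F G = sin (angle_inf (angles_between F G `\ 0)).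
Proof.
set A := _ `\ 0.
have [FG|nFG] := pselect (F `<=` G).
  (* No nonzero vector of F is orthogonal to M = F, so every gap bound holds;
     the bound 2 excludes all nonnegative spectral values except 1, hence all
     angles but 0. *)
  have -> : A = set0.
    rewrite -subset0 => t At; have gap2 : gap_bound F G 2.
      move=> f Ff fM; have -> : N f = 0 by apply: fM => //; exact: FG.
      by rewrite mulr0 sqnorm_ge0.
    have [sigma _] := angle_cos subF subG gap2 At.
    by have := sqr_ge0 sigma; lra.
  by rewrite /minimum_gap /angle_inf !asboolT// sin_pihalf.
have gap := gap_bound_minimum_gap subF subG nFG.
move: gap; set c := minimum_gap F G => gap.
have c0 : 0 <= c by exact: minimum_gap_ge0.
have c1 : c <= 1 by exact: minimum_gap_le1.
have pi0 := pi_gt0 R.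
have A_cos t : A t -> exists2 sigma, 0 <= sigma <= 1 /\ t = acos sigma & sigma ^+ 2 <= 1 - c ^+ 2.
  move=> At; have [sigma [s0 tE] le_s] := angle_cos subF subG gap At.
  exists sigma => //; split=> //; rewrite s0 -(@ler_pXn2r _ 2%N) ?nnegrE// expr1n.
  by have := sqr_ge0 c; lra.
have A_itv : A `<=` `[0, pi / 2].
  move=> t /A_cos[sigma [/[dup] sI /andP[s0 s1] ->] _]; rewrite /= in_itv/=.
  by rewrite acos_le_pihalf// andbT acos_ge0// s1 andbT; lra.
have [/andP[i0 i1] i_lb i_max] := angle_infP A_itv.
move: i0 i1 i_lb i_max; set i := angle_inf A => i0 i1 i_lb i_max.
have sin_le x y : - (pi / 2) <= x <= pi / 2 -> - (pi / 2) <= y <= pi / 2 ->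
    (sin x <= sin y) = (x <= y).
  by move=> hx hy; rewrite !leNgt ltr_sin// in_itv.
have c_itv : -1 <= c <= 1 by rewrite c1 andbT; lra.
have asin_itv : - (pi / 2) <= asin c <= pi / 2 by rewrite asin_geNpi2// asin_lepi2.
have sin_asin : sin (asin c) = c by rewrite asinK// in_itv.
have i_itv : - (pi / 2) <= i <= pi / 2 by rewrite i1 andbT; lra.
have sini0 : 0 <= sin i by apply: sin_ge0_pi; rewrite i0 /=; lra.
apply/le_anti/andP; split.
  rewrite -[leLHS]sin_asin sin_le//; apply: i_max; first by case/andP: asin_itv.
  move=> t At; have /andP[t0 t1] : 0 <= t <= pi / 2 by move: (A_itv t At); rewrite /= in_itv.
  rewrite -sin_le ?sin_asin//; last by rewrite t1 andbT; lra.
  have [sigma [/andP[s0 s1] ->] le_s] := A_cos t At.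
  rewrite sin_acos ?s1 ?andbT; last by lra.
  rewrite -(@ler_pXn2r _ 2%N) ?nnegrE ?sqrtr_ge0// sqr_sqrtr; first lra.
  by have := sqr_ge0 c; lra.
(* If the gap were below sin i, there would be spectral values beyond the one
   given by the angle i, hence an angle smaller than i. *)
rewrite leNgt; apply/negP => lt_c.
have e0 : 0 < sin i ^+ 2 by rewrite exprn_gt0// (le_lt_trans c0).
have e1 : sin i ^+ 2 <= 1 by rewrite expr_le1// sin_le1.
suff : gap_bound F G (sin i ^+ 2).
  by move=> /(le_minimum_gap subF subG nFG sini0); rewrite leNgt lt_c.
apply: (spectrum_gap_bound subF subG e0) => l /andP[l0 l1] ap.
have Al : A (acos (Num.sqrt l)) by apply: approx_null_angle => //; rewrite l1 andbT; lra.
have := i_lb _ Al; rewrite -sin_le//.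
  have sl : Num.sqrt l ^+ 2 = l by rewrite sqr_sqrtr//; lra.
  rewrite sin_acos; last first.
    rewrite -[X in _ && X](@ler_pXn2r _ 2%N) ?nnegrE ?sqrtr_ge0// sl expr1n (ltW l1) andbT.
    by have := sqrtr_ge0 l; lra.
  rewrite -(@ler_pXn2r _ 2%N) ?nnegrE ?sqrtr_ge0// sl sqr_sqrtr; lra.
by have := A_itv _ Al; rewrite /= in_itv /= => /andP[t0 ->]; rewrite andbT; lra.
Qed.
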